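(* There exists an absolute constant $C'>0$ such that the following holds. Let $n\ge 1$, $T\ge 1$ and $k\in\{1,\dots,T\}$, and let $\mathfrak{A}$ be the algorithm that queries the best-action oracle (and plays the revealed arm) in each of the first $k$ rounds, then discards all information collected so far, initializes UCB-V from scratch, and runs it (without queries) for the remaining $T-k$ rounds. Then, for every $n$-armed bandit instance with stochastic i.i.d. rewards in $[0,1]$, \[ R_{T,k}(\mathfrak{A})\ \le\ C'\,\min\left\{\frac{nT\log T}{k},\ \sqrt{nT\log T}\right\}. \]
   Context: Multi-armed bandits with best-action queries. There are $n$ arms and a horizon of $T$ rounds. At each round $t$ a reward vector $X_t=(X_{t,1},\dots,X_{t,n})\in[0,1]^n$ is generated. In the stochastic i.i.d. setting, arm $i$ has an unknown reward distribution $D_i$ on $[0,1]$, and $X_{t,i}\sim D_i$ independently across rounds $t$ and arms $i$. The learner may query an oracle in at most $k$ rounds, deciding whether to query before seeing anything about $X_t$. If it queries at round $t$, the oracle reveals an arm $i_t^\star\in\arg\max_i X_{t,i}$, the learner plays $I_t=i_t^\star$ and observes $X_{t,i_t^\star}$. Otherwise it selects an arm $I_t$ and observes only $X_{t,I_t}$. The regret is \[ R_{T,k}(\mathfrak{A})=\max_{i}\sum_{t=1}^T\mathbb{E}[X_{t,i}]-\mathbb{E}\Big[\sum_{t=1}^T X_{t,I_t}\Big]. \] UCB-V (Audibert, Munos and Szepesvári, 2009) is the following variance-aware standard bandit algorithm for rewards in $[0,1]$. At its $t$-th round it plays an arm maximizing the index \[ \widehat\mu_{i}+\sqrt{\frac{2\,\widehat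 V_{i}\,\zeta\log t}{s_i}}+\frac{3\,\zeta\log t}{s_i}, \] where $s_i$ is the number of previous plays of arm $i$, $\widehat\mu_i$ and $\widehat V_i$ are the empirical mean and empirical variance of the rewards observed from arm $i$ in those plays, the index is $+\infty$ if $s_i=0$, and $\zeta=1.2$. Known guarantee of UCB-V (from the literature, may be assumed). There is an absolute constant $C>0$ such that, for every horizon $M\ge 2$ and every arm $i$ with $\Delta_i:=\max_j\mu_j-\mu_i>0$, where $\mu_i$ and $\sigma_i^2$ are the mean and variance of $D_i$, the expected number of plays $\mathbb{E}[N_i(M)]$ of arm $i$ in $M$ rounds satisfies $\Delta_i\,\mathbb{E}[N_i(M)]\le C\left(\frac{\sigma_i^2}{\Delta_i}+1\right)\log M$. *)

(* Defs.v *)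
From HB Require Import structures.
From mathcomp Require Import all_boot all_order all_algebra.
From mathcomp Require Import all_classical all_reals all_analysis.
Set Implicit Arguments.
Unset Strict Implicit.
Unset Printing Implicit Defensive.
Import Order.TTheory GRing.Theory Num.Theory.
Local Open Scope classical_set_scope.
Local Open Scope ring_scope.

(* Conventions: rounds are numbered from 0, so that the rounds of horizon T
   are t < T; arms are the elements of 'I_n; X t i w is the reward of arm i
   at round t in the outcome w. *)

(** UCB-V *)

(* The (arm, observed reward) pairs, oldest first. *)
Definition history (R : realType) (n : nat) := seq ('I_n * R).

Definition arm_rewards (R : realType) (n : nat) (h : history R n) (i : 'I_n)
    : seq R :=
  [seq x.2 | x <- h & x.1 == i].

Definition emp_mean (R : realType) (s : seq R) : R :=
  (\sum_(x <- s) x) / (size s)%:R.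

(* Normalized by the sample size, as in Audibert, Munos and Szepesvari. *)
Definition emp_var (R : realType) (s : seq R) : R :=
  (\sum_(x <- s) (x - emp_mean s) ^+ 2) / (size s)%:R.

Definition ucbv_zeta (R : realType) : R := 12 / 10.

(* After the history h, UCB-V is about to play its (size h).+1-th round, with
   rounds counted from 1; this is the t of log t. *)
Definition ucbv_index (R : realType) (n : nat) (h : history R n) (i : 'I_n)
    : \bar R :=
  let s := arm_rewards h i in
  let L := ucbv_zeta R * ln (size h).+1%:R in
  if size s == 0%N then +oo%E
  else (emp_mean s + Num.sqrt (2 * emp_var s * L / (size s)%:R)
        + 3 * L / (size s)%:R)%:E.

(* A policy selects an arm from a seed, drawn once and independent of the
   rewards (see iid_rewards), and the history. The seed serves only to allow
   randomized tie-breaking. *)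
Definition policy (R : realType) (n : nat) (S : Type) :=
  S -> history R n -> 'I_n.

(* For each sequence of past arms, the selected arm is a measurable function
   of the seed and of the past rewards. *)
Definition measurable_policy (R : realType) (n : nat) (dS : measure_display)
    (S : measurableType dS) (pi : policy R n S) : Prop :=
  forall (m : nat) (a : m.-tuple 'I_n) (i : 'I_n),
    measurable [set ur : S * m.-tuple (measurableTypeR R) |
                 pi ur.1 (zip a ur.2) = i].

(* UCB-V is determined by its index up to the choice among the maximizers. *)
Definition is_ucbv (R : realType) (n : nat) (dS : measure_display)
    (S : measurableType dS) (pi : policy R n S) : Prop :=
  measurable_policy pi /\
  forall u h i, (ucbv_index h i <= ucbv_index h (pi u h))%E.

(** Running a policy *)

(* The history after m rounds of the policy pi with the seed u on the reward
   table x. *)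
Fixpoint run (R : realType) (n : nat) (S : Type) (pi : policy R n S) (u : S)
    (x : nat -> 'I_n -> R) (m : nat) : history R n :=
  if m is m'.+1 then
    let h := run pi u x m' in rcons h (pi u h, x m' (pi u h))
  else [::].

Definition played (R : realType) (n : nat) (S : Type) (pi : policy R n S)
    (u : S) (x : nat -> 'I_n -> R) (t : nat) : 'I_n :=
  pi u (run pi u x t).

(** Stochastic i.i.d. rewards *)

(* X t i has law D i, takes values in [0, 1], and the family of all the X t i
   with t < T, together with the seed U, is mutually independent. As the family
   is finite and any of the events may be taken to be full, the product rule for
   the whole family subsumes the one for its subfamilies. *)
Definition iid_rewards (R : realType) (n : nat)
    (d : measure_display) (Omega : measurableType d) (P : probability Omega R)
    (dS : measure_display) (S : measurableType dS) (U : Omega -> S)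
    (D : 'I_n -> probability (measurableTypeR R) R)
    (X : nat -> 'I_n -> Omega -> R) (T : nat) : Prop :=
  [/\ measurable_fun setT U,
      forall t i, (t < T)%N -> measurable_fun setT (X t i),
      forall t i w, (t < T)%N -> 0 <= X t i w <= 1,
      forall t i (A : set (measurableTypeR R)), (t < T)%N -> measurable A ->
        P (X t i @^-1` A) = D i A
    & forall (V : set S) (B : nat -> 'I_n -> set (measurableTypeR R)),
        measurable V -> (forall t i, measurable (B t i)) ->
        P [set w | V (U w) /\ forall t i, (t < T)%N -> B t i (X t i w)] =
        (P (U @^-1` V) * \prod_(t < T) \prod_(i < n) P (X t i @^-1` B t i))%E].

Definition arm_mean (R : realType) (n : nat)
    (D : 'I_n -> probability (measurableTypeR R) R) (i : 'I_n) : R :=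
  fine 'E_(D i)[fun x => x].

Definition arm_variance (R : realType) (n : nat)
    (D : 'I_n -> probability (measurableTypeR R) R) (i : 'I_n) : R :=
  fine (variance (D i) (fun x => x)).

Definition gap (R : realType) (n : nat)
    (D : 'I_n -> probability (measurableTypeR R) R) (i : 'I_n) : R :=
  \big[Num.max/arm_mean D i]_(j < n) arm_mean D j - arm_mean D i.

(* The bound of Audibert, Munos and Szepesvari on the number of plays of a
   suboptimal arm by UCB-V, with the constant C. *)
Definition ucbv_plays_bound (R : realType) (C : R) : Prop :=
  forall (n M : nat), (2 <= M)%N ->
  forall (d : measure_display) (Omega : measurableType d)
         (P : probability Omega R)
         (dS : measure_display) (S : measurableType dS) (U : Omega -> S)
         (D : 'I_n -> probability (measurableTypeR R) R)
         (X : nat -> 'I_n -> Omega -> R) (pi : policy R n S),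
  iid_rewards P U D X M -> is_ucbv pi ->
  forall i : 'I_n, 0 < gap D i ->
  ((gap D i)%:E *
     'E_P[fun w => (\sum_(t < M)
       (played pi (U w) (fun s j => X s j w) t == i))%N%:R] <=
   (C * (arm_variance D i / gap D i + 1) * ln M%:R)%:E)%E.

(** Best-action queries *)

(* Any tie-breaking of the oracle is allowed. *)
Definition best_action_oracle (R : realType) (n : nat) (Omega : Type)
    (X : nat -> 'I_n -> Omega -> R) (T : nat) (istar : nat -> Omega -> 'I_n)
    : Prop :=
  forall t w, (t < T)%N -> forall j, X t j w <= X t (istar t w) w.

(* The arm of round t when the oracle is queried in the first k rounds and pi
   then starts from the empty history. *)
Definition query_then_run (R : realType) (n : nat) (Omega S : Type) (k : nat)
    (istar : nat -> Omega -> 'I_n) (pi : policy R n S) (U : Omega -> S)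
    (X : nat -> 'I_n -> Omega -> R) (t : nat) (w : Omega) : 'I_n :=
  if (t < k)%N then istar t w
  else played pi (U w) (fun s j => X (k + s)%N j w) (t - k).

(* The regret over T rounds of the played arms I. *)
Definition regret (R : realType) (n : nat) (d : measure_display)
    (Omega : measurableType d) (P : probability Omega R)
    (X : nat -> 'I_n -> Omega -> R) (T : nat) (I : nat -> Omega -> 'I_n)
    : \bar R :=
  (\big[maxe/-oo]_(i < n) (\sum_(t < T) 'E_P[X t i])
   - 'E_P[fun w => (\sum_(t < T) X t (I t w) w)%R])%E.

(* Main.v *)
(* Write mu* for the best mean, g for the expected advantage of a queried round
   over mu*, and Delta_i, sigma_i^2, N_i for the gap, the variance and the
   expected number of plays of arm i after the queries. The regret is at most
   sum_i Delta_i N_i - k g. Comparing the oracle with playing the better of i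
   and a best arm in each round, max(x, y) - y >= ((x - y)^2 + (x - y)) / 2 on
   [0, 1] and independence give sigma_i^2 <= 2 g + Delta_i. So, up to a term of
   order n log T, only arms with Delta_i <= g matter, and for them the guarantee
   of UCB-V reads Delta_i^2 N_i <= O(g log T). By AM-GM,
   Delta_i N_i <= a Delta_i^2 N_i + N_i / (4 a); for a of order k / (n log T)
   the first terms sum to at most k g, which the queries pay for, and the
   others to O(n T log T / k). With sigma_i^2, Delta_i <= 1 in place of g, the
   choice a = sqrt (T / (n log T)) gives the other bound. *)
Require Import Defs.
From HB Require Import structures.
From mathcomp Require Import all_boot all_order all_algebra.
From mathcomp Require Import all_classical all_reals all_analysis.
From mathcomp Require Import ring lra measurable_realfun.
Set Implicit Arguments.
Unset Strict Implicit.
Unset Printing Implicit Defensive.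
Import Order.TTheory GRing.Theory Num.Theory.
Local Open Scope classical_set_scope.
Local Open Scope ring_scope.

(** * Real inequalities *)

(** The difference of the two sides is [N / (4 * a)] times the square of [2 * a * x - 1]. The weight
    [a] is chosen later. *)
Lemma am_gm_gap (R : realType) (a x N : R) : 0 < a -> 0 <= N ->
  x * N <= a * (x ^+ 2 * N) + N / (4 * a).
Proof.
move=> a0 N0; rewrite -subr_ge0.
rewrite (_ : _ - _ = N / (4 * a) * (2 * a * x - 1) ^+ 2); last first.
  by field; rewrite lt0r_neq0.
by rewrite mulr_ge0 ?sqr_ge0// divr_ge0// mulr_ge0// ltW.
Qed.

(** For a positive gap, compare it with [g]. If [g <= Delta i], then [v i <= 3 * Delta i] and
    dividing by the gap gives [Delta i * N i <= 4 * A]. Otherwise [v i + Delta i <= 4 * g], and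
    AM-GM applies. *)
Lemma sum_gap_bound_gain (R : realType) (I : finType) (Delta N v : I -> R)
    (A M g a : R) :
  0 < a -> 0 <= A -> 0 <= g ->
  (forall i, 0 <= Delta i) -> (forall i, 0 <= N i) -> \sum_i N i <= M ->
  (forall i, Delta i * (Delta i * N i) <= A * (v i + Delta i)) ->
  (forall i, 0 < Delta i -> v i <= 2 * g + Delta i) ->
  \sum_i Delta i * N i <=
    #|I|%:R * (4 * A) + a * (#|I|%:R * (4 * A * g)) + M / (4 * a).
Proof.
move=> a0 A0 g0 D0 N0 NM DN vg.
apply: (@le_trans _ _ (\sum_i (4 * A + a * (4 * A * g) + N i / (4 * a)))).
  apply: ler_sum => i _.
  have Na : 0 <= N i / (4 * a) by rewrite divr_ge0// mulr_ge0// ltW.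
  have aAg : 0 <= a * (4 * A * g) by rewrite !mulr_ge0// ltW.
  have [->|Di_neq0] := eqVneq (Delta i) 0; first by rewrite mul0r; lra.
  have Di0 : 0 < Delta i by rewrite lt_neqAle eq_sym Di_neq0 D0.
  have := DN i; have := vg i Di0; have [gD|Dg] := leP g (Delta i) => vi DNi.
    suff : Delta i * N i <= 4 * A by lra.
    rewrite -(ler_pM2l Di0); apply: (le_trans DNi).
    have : A * (v i + Delta i) <= A * (4 * Delta i) by rewrite ler_wpM2l//; lra.
    by lra.
  apply: (le_trans (am_gm_gap (Delta i) a0 (N0 i))).
  rewrite expr2 -mulrA.
  have : A * (v i + Delta i) <= 4 * A * g.
    by rewrite (mulrC 4) -mulrA ler_wpM2l//; lra.
  by move=> /(le_trans DNi) /(ler_wpM2l (ltW a0)); lra.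
rewrite big_split/= sumr_const -mulr_suml -[_ *+ _]mulr_natl.
have : (\sum_i N i) / (4 * a) <= M / (4 * a).
  by rewrite ler_wpM2r// invr_ge0 mulr_ge0// ltW.
by lra.
Qed.

Lemma sum_gap_bound (R : realType) (I : finType) (Delta N : I -> R)
    (A M a : R) :
  0 < a -> (forall i, 0 <= N i) -> \sum_i N i <= M ->
  (forall i, Delta i * (Delta i * N i) <= A) ->
  \sum_i Delta i * N i <= a * (#|I|%:R * A) + M / (4 * a).
Proof.
move=> a0 N0 NM DN.
apply: (@le_trans _ _ (\sum_i (a * A + N i / (4 * a)))).
  apply: ler_sum => i _; apply: (le_trans (am_gm_gap (Delta i) a0 (N0 i))).
  by rewrite lerD2r ler_wpM2l ?(ltW a0)// expr2 -mulrA.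
rewrite big_split/= sumr_const -mulr_suml -[_ *+ _]mulr_natl.
have : (\sum_i N i) / (4 * a) <= M / (4 * a).
  by rewrite ler_wpM2r// invr_ge0 mulr_ge0// ltW.
by lra.
Qed.

(** The two bounds come from two choices of the AM-GM weight. The term [- k * g] pays for the gain
    term in the first and is dropped in the second. *)
Lemma regret_min_bound (R : realType) (n : nat) (T k L B g : R)
    (Delta N v : 'I_n -> R) :
  (0 < n)%N -> 0 < k <= T -> 0 < L -> 1 <= B -> 0 <= g ->
  (forall i, 0 <= Delta i <= 1) -> (forall i, 0 <= N i) ->
  \sum_i N i <= T -> (forall i, 0 <= v i <= 1) ->
  (forall i, Delta i * (Delta i * N i) <= B * L * (v i + Delta i)) ->
  (forall i, 0 < Delta i -> v i <= 2 * g + Delta i) ->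
  \sum_i Delta i * N i - k * g <=
    5 * B * Num.min (n%:R * T * L / k) (Num.sqrt (n%:R * T * L)).
Proof.
move=> n0 /andP[k0 kT] L0 B1 g0 D01 N0 NT v01 DN vg.
have B0 : 0 < B by lra.
have T0 : 0 < T by lra.
have nR : 0 < n%:R :> R by rewrite ltr0n.
have BL0 : 0 <= B * L by rewrite mulr_ge0 ?ltW.
rewrite minr_pMr; last by lra.
rewrite le_min; apply/andP; split.
  (* This weight makes the gain term of [sum_gap_bound_gain] equal to [k * g]. *)
  have a0 : 0 < k / (4 * B * L * n%:R) by rewrite divr_gt0// !mulr_gt0.
  have D0 i : 0 <= Delta i by have /andP[] := D01 i.
  have := sum_gap_bound_gain a0 BL0 g0 D0 N0 NT DN vg; rewrite card_ord.
  have -> : k / (4 * B * L * n%:R) * (n%:R * (4 * (B * L) * g)) = k * g.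
    by field; rewrite !lt0r_neq0.
  have -> : T / (4 * (k / (4 * B * L * n%:R))) = B * (n%:R * T * L / k).
    by field; rewrite !lt0r_neq0.
  (* Since [k <= T], the term without the weight takes at most four of the five shares of the bound;
     [T / (4 * a)] is the fifth. *)
  have : n%:R * (4 * (B * L)) <= 4 * B * (n%:R * T * L / k).
    rewrite (_ : n%:R * T * L / k = n%:R * L * (T / k)); last by ring.
    have : 1 <= T / k by rewrite ler_pdivlMr// mul1r.
    have : 0 < 4 * B * (n%:R * L) by rewrite !mulr_gt0.
    by move=> h /(ler_wpM2l (ltW h)); lra.
  by lra.
set s := Num.sqrt _.
have s0 : 0 < s by rewrite sqrtr_gt0 !mulr_gt0.
have sE : T * (n%:R * L) = s * s.
  by rewrite -expr2 sqr_sqrtr ?mulr_ge0 ?ltW//; ring.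
(* This weight is the square root of [T / (n * L)]; both terms are then multiples of [s]. *)
have a0 : 0 < s / (n%:R * L) by rewrite divr_gt0// mulr_gt0.
have DN' i : Delta i * (Delta i * N i) <= 2 * B * L.
  apply: (le_trans (DN i)); rewrite [leRHS](_ : _ = B * L * 2); last by ring.
  rewrite ler_wpM2l//.
  by have /andP[_ ?] := v01 i; have /andP[_ ?] := D01 i; lra.
have := sum_gap_bound a0 N0 NT DN'; rewrite card_ord.
have -> : s / (n%:R * L) * (n%:R * (2 * B * L)) = 2 * B * s.
  by field; rewrite !lt0r_neq0.
have -> : T / (4 * (s / (n%:R * L))) = s / 4.
  rewrite (_ : _ / _ = T * (n%:R * L) / (4 * s)); last first.
    by field; rewrite !lt0r_neq0.
  by rewrite sE; field; rewrite lt0r_neq0.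
have : s <= B * s by rewrite ler_peMl// ltW.
have : 0 <= k * g by rewrite mulr_ge0// ltW.
lra.
Qed.

(** * Expectations *)

Section expectation_complements.
Context d (Omega : measurableType d) (R : realType) (P : probability Omega R).

Lemma bounded_Lfun1 (f : Omega -> R) (c : R) : measurable_fun setT f ->
  (forall w, `|f w| <= c) -> f \in Lfun P 1.
Proof.
move=> mf fc; apply/Lfun1_integrable.
apply: measurable_bounded_integrable => //.
  by apply: (le_lt_trans (probability_le1 P measurableT)); exact: ltry.
exists c; split; first exact: num_real.
by move=> x cx w _ /=; apply: (le_trans (fc w)); exact: ltW.
Qed.

Lemma Lfun1_le_expectation (f g : Omega -> R) :
  f \in Lfun P 1 -> g \in Lfun P 1 -> (forall w, f w <= g w) ->
  ('E_P[f] <= 'E_P[g])%E.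
Proof.
move=> /Lfun1_integrable fi /Lfun1_integrable gi fg; rewrite unlock.
by apply: le_integral => // w _; rewrite lee_fin.
Qed.

Lemma expectation_sum_ord (m : nat) (F : 'I_m -> Omega -> R) :
  (forall i, F i \in Lfun P 1) ->
  ('E_P[fun w => (\sum_(i < m) F i w)%R] = \sum_(i < m) 'E_P[F i])%E.
Proof.
move=> Fi; rewrite unlock.
under eq_integral do rewrite -sumEFin.
by rewrite integral_sum// => i; apply/Lfun1_integrable.
Qed.

(** The product rule on events makes the law of the pair the product of the two laws, and Tonelli
    splits the integral. *)
Lemma expectation_indep_mul (Y Z : Omega -> R) :
  measurable_fun setT Y -> measurable_fun setT Z ->
  (forall w, 0 <= Y w) -> (forall w, 0 <= Z w) ->
  (forall A B : set (R), measurable A -> measurable B ->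
     P (Y @^-1` A `&` Z @^-1` B) = (P (Y @^-1` A) * P (Z @^-1` B))%E) ->
  ('E_P[fun w => (Y w * Z w)%R] = 'E_P[Y] * 'E_P[Z])%E.
Proof.
move=> mY mZ Y0 Z0 YZ; rewrite unlock.
pose Y' : {mfun Omega >-> R} :=
  HB.pack Y (isMeasurableFun.Build _ _ _ _ Y mY).
pose Z' : {mfun Omega >-> R} :=
  HB.pack Z (isMeasurableFun.Build _ _ _ _ Z mZ).
have mYZ : measurable_fun setT
  (fun w => (Y w, Z w) : R * R).
  exact: measurable_fun_pair.
pose YZ' : {mfun Omega >-> (R * R)%type} :=
  HB.pack (fun w => (Y w, Z w) : R * R)
    (isMeasurableFun.Build _ _ _ _ _ mYZ).
(* [absE] agrees with the identity on the values of [Y] and [Z] and is nonnegative on the whole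
   line, as the change of variables and Tonelli require. *)
pose absE (x : R) : \bar R := `|x|%:E.
have mabs : measurable_fun setT absE.
  by apply/measurable_EFinP; exact: normr_measurable.
have abs0 x : (0 <= absE x)%E by rewrite lee_fin.
have YE : (\int[P]_w (Y w)%:E = \int[distribution P Y']_x absE x)%E.
  rewrite (ge0_integral_distribution _ mabs abs0).
  by apply: eq_integral => w _; rewrite /absE/= ger0_norm.
have ZE : (\int[P]_w (Z w)%:E = \int[distribution P Z']_x absE x)%E.
  rewrite (ge0_integral_distribution _ mabs abs0).
  by apply: eq_integral => w _; rewrite /absE/= ger0_norm.
pose f (x : R * R) := (absE x.1 * absE x.2)%E.
have mf : measurable_fun setT f.
  by apply: emeasurable_funM; exact: (measurableT_comp mabs).
have f0 x : (0 <= f x)%E by rewrite mule_ge0.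
transitivity (\int[distribution P YZ']_x f x)%E.
  rewrite (ge0_integral_distribution _ mf f0).
  by apply: eq_integral => w _ /=; rewrite /f/absE/= !ger0_norm// EFinM.
transitivity (\int[(distribution P Y' \x distribution P Z')%E]_x f x)%E.
  apply: eq_measure_integral => A mA _.
  by apply/esym/product_measure_unique => //.
rewrite fubini_tonelli1//= /fubini_F /f/=.
under eq_integral do rewrite ge0_integralZl//.
rewrite ge0_integralZr//; last by apply: integral_ge0.
by rewrite -YE -ZE.
Qed.
End expectation_complements.

(** * Measurability of the played arm *)

Lemma size_run (R : realType) (n : nat) (S : Type)
    (pi : policy R n S) (u : S) (x : nat -> 'I_n -> R) m :
  size (run pi u x m) = m.
Proof. by elim: m => //= m IH; rewrite size_rcons IH. Qed.

Lemma nth_run (R : realType) (n : nat) (S : Type)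
    (pi : policy R n S) (u : S) (x : nat -> 'I_n -> R) m s i0 : (s < m)%N ->
  nth (i0, 0) (run pi u x m) s = (played pi u x s, x s (played pi u x s)).
Proof.
elim: m => // m IH; rewrite ltnS leq_eqVlt /= nth_rcons size_run.
by case/orP => [/eqP ->|sm]; [rewrite ltnn eqxx|rewrite sm IH].
Qed.

(** Brings the history, once the past arms are fixed, to the form in which [measurable_policy]
    speaks of it. *)
Lemma run_zip (R : realType) (n : nat) (S : Type)
    (pi : policy R n S) (u : S) (x : nat -> 'I_n -> R) m (a : m.-tuple 'I_n) :
  (forall s : 'I_m, played pi u x s = tnth a s) ->
  run pi u x m = zip a [tuple x s (tnth a s) | s < m].
Proof.
(* Without arms [nth] has no default pair, but then [m] must be 0. *)
case: n pi x a => [|n'] pi x a pa.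
  case: m a pa => [|m] a _; last by case: (tnth a ord0).
  by apply/esym/size0nil; rewrite size_zip !size_tuple.
apply: (@eq_from_nth _ (ord0, 0)) => [|s].
  by rewrite size_run size_zip !size_tuple minnn.
rewrite size_run => sm.
rewrite nth_run// nth_zip ?size_tuple// -[s]/(val (Ordinal sm)).
by rewrite -!tnth_nth tnth_mktuple -pa.
Qed.

Section played_measurable.
Context d (T : measurableType d) (R : realType) (n : nat)
  (dS : measure_display)
  (S : measurableType dS).
Implicit Types (pi : policy R n S) (U : T -> S) (Y : nat -> 'I_n -> T -> R).

(** Strong induction on the round: the event splits over the finitely many past arm sequences [a],
    and on each piece the history is [a] zipped with measurable rewards. The space is arbitrary so
    that a smaller sigma-algebra on the outcomes can be used for independence. *)
Lemma measurable_played pi U Y m : measurable_policy pi ->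
  measurable_fun setT U ->
  (forall s j, (s < m)%N -> measurable_fun setT (Y s j)) ->
  forall i, measurable [set w | played pi (U w) (fun s j => Y s j w) m = i].
Proof.
move=> mpi mU.
elim/ltn_ind: m => m IH mY i.
have mplayed s j : (s < m)%N ->
    measurable [set w | played pi (U w) (fun s j => Y s j w) s = j].
  by move=> sm; apply: IH => // r k rs; apply: mY; exact: ltn_trans sm.
pose Za (a : m.-tuple 'I_n) w : S * m.-tuple (measurableTypeR R) :=
  (U w, [tuple Y s (tnth a s) w | s < m]).
have mZa a : measurable_fun setT (Za a).
  apply: measurable_fun_pair => //; apply/measurable_fun_tnthP => s.
  rewrite (_ : _ \o _ = Y s (tnth a s)); first exact: mY.
  by apply/funext => w /=; rewrite tnth_mktuple.
rewrite (_ : [set _ | _] = \bigcup_(a in [set: m.-tuple 'I_n])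
   ((\bigcap_(s in [set: 'I_m])
      [set w | played pi (U w) (fun s j => Y s j w) s = tnth a s]) `&`
   Za a @^-1` [set ur : S * m.-tuple (measurableTypeR R) |
     pi ur.1 (zip a ur.2) = i])); last first.
  apply/seteqP; split => w /=.
    move=> pi_i.
    pose a := [tuple played pi (U w) (fun s j => Y s j w) s | s < m].
    have aE (s : 'I_m) : played pi (U w) (fun s j => Y s j w) s = tnth a s.
      by rewrite tnth_mktuple.
    exists a => //; split=> [s _ /=|]; first exact: aE.
    by rewrite /Za/=; have /= <- := run_zip aE.
  move=> [a _ [pa] /=]; rewrite /Za/=.
  by have /= <- := run_zip (fun s => pa s I).
apply: fin_bigcup_measurable => // a _.
apply: measurableI.
  by apply: fin_bigcap_measurable => // s _; exact: mplayed.
by rewrite -[X in measurable X]setTI; apply: mZa => //; exact: mpi.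
Qed.
End played_measurable.

(** * Independence and moments of the rewards *)

Section independence.
Context (R : realType) (n : nat) d (Omega : measurableType d)
  (P : probability Omega R) (dS : measure_display) (S : measurableType dS)
  (U : Omega -> S) (D : 'I_n -> probability (measurableTypeR R) R)
  (X : nat -> 'I_n -> Omega -> R) (T : nat).

(* The pi-system of rectangles generating the sigma-algebra of the seed and of
   all the rewards except X t i, which [B t i = setT] leaves free. *)
Definition other_rewards_rect (t : nat) (i : 'I_n) : set (set Omega) :=
  [set E | exists V (B : nat -> 'I_n -> set (measurableTypeR R)),
    [/\ measurable V, forall s j, measurable (B s j), B t i = setT &
     E = [set w | V (U w) /\ forall s j, (s < T)%N -> B s j (X s j w)]]].

Lemma other_rewards_rect_setI t i : setI_closed (other_rewards_rect t i).
Proof.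
move=> _ _ [V [B [mV mB Bti ->]]] [V' [B' [mV' mB' B'ti ->]]].
exists (V `&` V'), (fun s j => B s j `&` B' s j); split.
- exact: measurableI.
- by move=> s j; exact: measurableI.
- by rewrite Bti B'ti setIT.
- apply/seteqP; split => w /=.
    move=> [[Vw Bw] [V'w B'w]]; split=> // s j sT.
    by split; [exact: Bw|exact: B'w].
  by move=> [[Vw V'w] BB]; split; split=> // s j sT; have [] := BB s j sT.
Qed.

Hypothesis iidX : iid_rewards P U D X T.

Lemma iid_rewards_measurable_seed : measurable_fun setT U.
Proof. by case: iidX. Qed.

Lemma iid_rewards_measurable t i : (t < T)%N -> measurable_fun setT (X t i).
Proof. by move=> tT; case: iidX => _ /(_ t i tT). Qed.

Lemma iid_rewards_preimage_measurable t i (B : set R) : (t < T)%N ->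
  measurable B -> measurable (X t i @^-1` B).
Proof.
move=> tT mB; rewrite -[X in measurable X]setTI.
exact: iid_rewards_measurable.
Qed.

Lemma iid_rewards_rect_measurable (V : set S)
    (B : nat -> 'I_n -> set (measurableTypeR R)) :
  measurable V -> (forall s j, measurable (B s j)) ->
  measurable [set w | V (U w) /\ forall s j, (s < T)%N -> B s j (X s j w)].
Proof.
move=> mV mB.
rewrite (_ : [set _ | _] = U @^-1` V `&`
  \bigcap_(s in [set: 'I_T]) \bigcap_(j in [set: 'I_n])
    (X s j @^-1` B s j)); last first.
  apply/seteqP; split => w /= [Vw Bw]; split=> //.
    by move=> s _ j _; exact: Bw.
  by move=> s j sT; exact: (Bw (Ordinal sT) I j I).
apply: measurableI.
  by rewrite -[X in measurable X]setTI; exact: iid_rewards_measurable_seed.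
apply: fin_bigcap_measurable => // s _; apply: fin_bigcap_measurable => // j _.
exact: (iid_rewards_preimage_measurable j (ltn_ord s) (mB s j)).
Qed.

(** Filling the free slot [(t, i)] of the rectangle with [B] gives the intersection, and the product
    rule applies to the rectangle before and after. *)
Lemma other_rewards_rect_indep t i E (B : set R) : (t < T)%N ->
  other_rewards_rect t i E -> measurable B ->
  P (E `&` X t i @^-1` B) = (P E * P (X t i @^-1` B))%E.
Proof.
move=> tT [V [C [mV mC Cti ->]]] mB.
have [_ _ _ _ prodP] := iidX.
pose C' s j : set (measurableTypeR R) :=
  if (s == t) && (j == i) then B else C s j.
have mC' s j : measurable (C' s j) by rewrite /C'; case: ifP.
rewrite (_ : _ `&` _ =
  [set w | V (U w) /\ forall s j, (s < T)%N -> C' s j (X s j w)]); last first.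
  apply/seteqP; split => w /=.
    move=> [[Vw Cw] Bw]; split=> // s j sT; rewrite /C'.
    by case: ifPn => [/andP[/eqP -> /eqP ->]//|_]; exact: Cw.
  move=> [Vw C'w]; split; [split=> //|].
    move=> s j sT; have := C'w s j sT; rewrite /C'.
    by case: ifPn => // /andP[/eqP -> /eqP ->] _; rewrite Cti.
  by have := C'w t i tT; rewrite /C' !eqxx.
rewrite !prodP// -muleA; congr (_ * _)%E.
have C'E (s : 'I_T) (j : 'I_n) : P (X s j @^-1` C' s j) =
  (P (X s j @^-1` C s j) *
   if (s == Ordinal tT) && (j == i) then P (X t i @^-1` B) else 1)%E.
  have sE : (s == t :> nat) = (s == Ordinal tT) by [].
  rewrite /C' sE; case: ifPn; last by rewrite mule1.
  move=> /andP[/eqP -> /eqP ->].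
  by rewrite Cti preimage_setT probability_setT mul1e.
under eq_bigr do under eq_bigr do rewrite C'E.
under eq_bigr do rewrite big_split/=.
rewrite big_split/=; congr (_ * _)%E.
rewrite (bigD1 (Ordinal tT))//= (bigD1 i)//= !eqxx/=.
rewrite big1 => [|j /negbTE ->//]; rewrite big1 ?mule1// => s /negbTE ->.
by rewrite big1.
Qed.

(** The pi-lambda theorem extends the product rule from the rectangles to the sigma-algebra that
    they generate. *)
Lemma other_rewards_indep t i E (B : set R) : (t < T)%N ->
  <<s other_rewards_rect t i >> E -> measurable B ->
  measurable E /\ P (E `&` X t i @^-1` B) = (P E * P (X t i @^-1` B))%E.
Proof.
move=> tT sE mB.
have mXB := iid_rewards_preimage_measurable i tT mB.
have sub : <<s other_rewards_rect t i >> `<=` @measurable _ Omega.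
  apply: smallest_sub; first exact: sigma_algebra_measurable.
  by move=> _ [V [C [mV mC _ ->]]]; exact: iid_rewards_rect_measurable.
have fin A : measurable A -> P A \is a fin_num.
  by move=> ?; exact: fin_num_measure.
split; first exact: sub.
move: E sE.
apply: (@dynkin_induction _ (g_sigma_algebraType (other_rewards_rect t i))
   (other_rewards_rect t i)
   [set E | P (E `&` X t i @^-1` B) = (P E * P (X t i @^-1` B))%E]).
- by [].
- exact: other_rewards_rect_setI.
- by rewrite /= setTI probability_setT mul1e.
- by move=> E /= ?; exact: other_rewards_rect_indep.
- move=> E; change (set Omega) in E => /sub mE /= PE.
  rewrite setIC -setDE measureD//; last by rewrite ltey_eq fin.
  transitivity (P (X t i @^-1` B) - P E * P (X t i @^-1` B))%E.
    by congr (_ - _)%E; rewrite setIC; exact: PE.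
  have -> : (P (~` E) = 1 - P E)%E by exact: probability_setC.
  by rewrite muleBl ?mul1e//; exact: fin.
- move=> F; change ((set Omega)^nat) in F => mF tF /= PF.
  rewrite setI_bigcupl measure_bigcup//=; last 2 first.
  + by move=> k _; apply: measurableI => //; apply: sub; exact: mF.
  + exact: trivIset_setIr.
  rewrite measure_bigcup//=; last by move=> k _; apply: sub; exact: mF.
  rewrite -[P (X t i @^-1` B)]fineK ?fin// muleC -nneseriesZl//.
  by apply: eq_eseriesr => k _; rewrite fineK ?fin// muleC; exact: PF.
Qed.

Lemma other_rewards_measurable_seed t i :
  measurable_fun setT (U : g_sigma_algebraType (other_rewards_rect t i) -> S).
Proof.
move=> _ V mV; rewrite setTI; apply: sub_sigma_algebra.
exists V, (fun _ _ => setT); split=> //.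
by apply/seteqP; split=> w //= [].
Qed.

(** The rectangle that constrains only [X s j] leaves the slot [(t, i)] free. *)
Lemma other_rewards_measurable t i s j : (s < T)%N -> (s, j) != (t, i) ->
  measurable_fun setT
    (X s j : g_sigma_algebraType (other_rewards_rect t i) -> R).
Proof.
move=> sT sjti _ A mA; rewrite setTI; apply: sub_sigma_algebra.
exists setT, (fun r l => if (r == s) && (l == j) then A else setT); split=> //.
- by move=> r l; case: ifP.
- rewrite ifF//; apply: contraNF sjti => /andP[/eqP -> /eqP ->].
  exact: eqxx.
- apply/seteqP; split=> w /=; last first.
    by move=> [_ /(_ s j sT)]; rewrite !eqxx.
  move=> Aw; split=> // r l rT.
  by case: ifP => // /andP[/eqP -> /eqP ->].
Qed.

Lemma iid_rewards_ge0 t i w : (t < T)%N -> 0 <= X t i w.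
Proof. by move=> tT; case: iidX => _ _ /(_ t i w tT) /andP[]. Qed.

Lemma iid_rewards_le1 t i w : (t < T)%N -> X t i w <= 1.
Proof. by move=> tT; case: iidX => _ _ /(_ t i w tT) /andP[]. Qed.

Lemma iid_rewards_Lfun t i : (t < T)%N -> X t i \in Lfun P 1.
Proof.
move=> tT; apply: (@bounded_Lfun1 _ _ _ _ _ 1).
  exact: iid_rewards_measurable.
by move=> w; rewrite ger0_norm ?iid_rewards_ge0 ?iid_rewards_le1.
Qed.

Lemma iid_rewardsM_Lfun t i j : (t < T)%N ->
  (fun w => X t i w * X t j w) \in Lfun P 1.
Proof.
move=> tT; apply: (@bounded_Lfun1 _ _ _ _ _ 1).
  by apply: measurable_funM; exact: iid_rewards_measurable.
move=> w; rewrite normrM !ger0_norm ?iid_rewards_ge0//.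
by rewrite mulr_ile1 ?iid_rewards_ge0 ?iid_rewards_le1.
Qed.

(** [arm_mean] and [arm_variance] are integrals against [D i]; this change of variables moves them
    to [P]. *)
Lemma iid_rewards_integral t i (f : R -> R) : (t < T)%N ->
  measurable_fun setT f -> f \o X t i \in Lfun P 1 ->
  ('E_(D i)[f] = 'E_P[f \o X t i])%E.
Proof.
move=> tT mf /Lfun1_integrable fX; rewrite unlock.
have mX : measurable_fun setT (X t i : Omega -> measurableTypeR R).
  exact: iid_rewards_measurable.
transitivity
  (\int[pushforward P (X t i : Omega -> measurableTypeR R)]_x (f x)%:E)%E.
  apply: eq_measure_integral => A mA _.
  by case: iidX => _ _ _ /(_ t i A tT mA).
by rewrite integral_pushforward//; apply/measurable_EFinP.
Qed.

Lemma iid_rewards_mean t i : (t < T)%N -> ('E_P[X t i] = (arm_mean D i)%:E)%E.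
Proof.
move=> tT; have Xi := iid_rewards_Lfun i tT.
rewrite /arm_mean (iid_rewards_integral tT _ Xi)//.
by rewrite fineK// expectation_fin_num.
Qed.

Lemma iid_rewards_sqr t i : (t < T)%N ->
  ('E_P[fun w => (X t i w * X t i w)%R] =
   (arm_variance D i + arm_mean D i ^+ 2)%:E)%E.
Proof.
move=> tT; have Xi := iid_rewards_Lfun i tT.
have XXi := iid_rewardsM_Lfun i i tT.
(* The right-hand side is the covariance of [X t i] with itself, to be identified with the variance
   under [D i]. *)
have -> : arm_variance D i =
    fine ('E_P[fun w => (X t i w * X t i w)%R] - 'E_P[X t i] * 'E_P[X t i])%E.
  rewrite -covarianceE// /arm_variance /variance [in RHS]unlock.
  rewrite iid_rewards_mean//= [in LHS]unlock.
  congr fine; rewrite -[fine _]/(arm_mean D i).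
  pose f x := (x - arm_mean D i) * (x - arm_mean D i).
  rewrite -[RHS]/('E_P[f \o X t i])%E -iid_rewards_integral//.
    by apply: measurable_funM; exact: measurable_funB.
  rewrite (_ : f \o X t i = (fun w => X t i w * X t i w) \+
     (- (2 * arm_mean D i)) \o* X t i \+ cst (arm_mean D i ^+ 2)); last first.
    by apply/funext => w /=; rewrite /f; ring.
  by rewrite !rpredD//= ?Lfun_scale ?Lfun_cst.
rewrite iid_rewards_mean// -EFinM fineB ?expectation_fin_num//= -expr2 subrK.
by rewrite fineK ?expectation_fin_num.
Qed.

(** Serves for [Y] the reward of another arm in the same round, and for [Y] the indicator that the
    policy plays arm [i]. *)
Lemma iid_rewards_indepM t i (Y : Omega -> R) : (t < T)%N ->
  measurable_fun setT
    (Y : g_sigma_algebraType (other_rewards_rect t i) -> R) ->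
  (forall w, 0 <= Y w) ->
  ('E_P[fun w => (Y w * X t i w)%R] = 'E_P[Y] * (arm_mean D i)%:E)%E.
Proof.
move=> tT mY Y0; rewrite -(iid_rewards_mean i tT).
have sY A : measurable A -> <<s other_rewards_rect t i >> (Y @^-1` A).
  by move=> mA; rewrite -[Y @^-1` A]setTI; exact: mY.
apply: expectation_indep_mul => //.
(* Measurability of [Y] for the full sigma-algebra is the first half of [other_rewards_indep]. *)
- move=> _ A mA; rewrite setTI.
  by have [] := other_rewards_indep tT (sY A mA) (@measurableT _ R).
- exact: iid_rewards_measurable.
- by move=> w; exact: iid_rewards_ge0.
- move=> A B mA mB; have [_] := other_rewards_indep tT (sY A mA) mB; exact.
Qed.

Lemma iid_rewardsM t i j : (t < T)%N -> i != j ->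
  ('E_P[fun w => (X t i w * X t j w)%R] = (arm_mean D i * arm_mean D j)%:E)%E.
Proof.
move=> tT ij; rewrite iid_rewards_indepM ?iid_rewards_mean//.
- by apply: other_rewards_measurable => //; rewrite xpair_eqE eqxx.
- by move=> w; exact: iid_rewards_ge0.
Qed.

Lemma arm_mean_ge0 i : (0 < T)%N -> 0 <= arm_mean D i.
Proof.
move=> T0; rewrite -lee_fin -(iid_rewards_mean i T0).
by apply: expectation_ge0 => w; exact: iid_rewards_ge0.
Qed.

Lemma arm_mean_le1 i : (0 < T)%N -> arm_mean D i <= 1.
Proof.
move=> T0; rewrite -lee_fin -(iid_rewards_mean i T0) -(expectation_cst P).
apply: Lfun1_le_expectation; [exact: iid_rewards_Lfun|exact: Lfun_cst|].
by move=> w; exact: iid_rewards_le1.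
Qed.

Lemma arm_variance_ge0 i : 0 <= arm_variance D i.
Proof. by rewrite fine_ge0// variance_ge0. Qed.

(** On [[0, 1]] a reward dominates its square, so the variance is at most the mean minus its
    square. *)
Lemma arm_variance_le1 i : (0 < T)%N -> arm_variance D i <= 1.
Proof.
move=> T0; have := arm_mean_ge0 i T0; have := arm_mean_le1 i T0 => m1 m0.
suff : arm_variance D i + arm_mean D i ^+ 2 <= arm_mean D i by nra.
rewrite -lee_fin -(iid_rewards_sqr i T0) -(iid_rewards_mean i T0).
apply: Lfun1_le_expectation;
  [exact: iid_rewardsM_Lfun|exact: iid_rewards_Lfun|].
by move=> w; rewrite ler_piMr ?iid_rewards_ge0 ?iid_rewards_le1.
Qed.
End independence.

(** * Regret *)

Section regret_decomposition.
Context (R : realType) (n : nat) d (Omega : measurableType d)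
  (P : probability Omega R) (dS : measure_display) (S : measurableType dS)
  (U : Omega -> S) (D : 'I_n -> probability (measurableTypeR R) R)
  (X : nat -> 'I_n -> Omega -> R) (T : nat).
Hypothesis iidX : iid_rewards P U D X T.

(** Whatever the tie-breaking, the reward of a best arm is the maximum over the arms, which is
    measurable; the base value 0 is harmless because rewards are nonnegative. *)
Lemma best_reward_Lfun t (I : Omega -> 'I_n) : (t < T)%N ->
  (forall w j, X t j w <= X t (I w) w) ->
  (fun w => X t (I w) w) \in Lfun P 1.
Proof.
move=> tT best; apply: (@bounded_Lfun1 _ _ _ _ _ 1); last first.
  move=> w; rewrite ger0_norm; first exact: (iid_rewards_le1 iidX).
  exact: (iid_rewards_ge0 iidX).
rewrite (_ : (fun w => _) = fun w => \big[Num.max/0]_(j < n) X t j w).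
  elim: index_enum => [|j s IH].
    by under eq_fun do rewrite big_nil; exact: measurable_cst.
  under eq_fun do rewrite big_cons; apply: measurable_maxr => //.
  exact: (iid_rewards_measurable iidX).
apply/funext => w; apply/eqP; rewrite eq_le le_bigmax/=.
by apply/bigmax_leP; split=> //; exact: (iid_rewards_ge0 iidX).
Qed.

Lemma best_reward_ge t (I : Omega -> 'I_n) j : (t < T)%N ->
  (forall w j, X t j w <= X t (I w) w) ->
  ((arm_mean D j)%:E <= 'E_P[fun w => X t (I w) w])%E.
Proof.
move=> tT best; rewrite -(iid_rewards_mean iidX j tT).
apply: Lfun1_le_expectation => //; first exact: (iid_rewards_Lfun iidX).
exact: best_reward_Lfun.
Qed.

(* [max(x, y) - y = (x - y)^+ >= ((x - y)^2 + (x - y)) / 2] when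
   [`|x - y| <= 1], and independence makes the variance of [X t i] a lower
   bound for that of [X t i - X t j]. *)
Lemma best_reward_gain t (I : Omega -> 'I_n) i j : (t < T)%N -> i != j ->
  (forall w j, X t j w <= X t (I w) w) ->
  ((arm_mean D j + (arm_variance D i - (arm_mean D j - arm_mean D i)) / 2)%:E
   <= 'E_P[fun w => X t (I w) w])%E.
Proof.
move=> tT ij best.
pose XX a b w := X t a w * X t b w.
(* With [x] for [X t i] and [y] for [X t j], this is [y + ((x - y)^2 + (x - y)) / 2] expanded into
   monomials. *)
pose h := 2^-1 \o* XX i i \+ (-1) \o* XX i j \+ 2^-1 \o* XX j j
  \+ 2^-1 \o* X t i \+ 2^-1 \o* X t j.
have XXL a b : XX a b \in Lfun P 1 by exact: (iid_rewardsM_Lfun iidX).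
have XL a : X t a \in Lfun P 1 by exact: (iid_rewards_Lfun iidX).
have hL : h \in Lfun P 1 by rewrite !rpredD//= Lfun_scale.
have : ('E_P[h] <= 'E_P[fun w => X t (I w) w])%E.
  apply: Lfun1_le_expectation => //; first exact: best_reward_Lfun.
  move=> w; rewrite /h/= /XX.
  have := best w i; have := best w j.
  have := iid_rewards_ge0 iidX i w tT; have := iid_rewards_le1 iidX i w tT.
  have := iid_rewards_ge0 iidX j w tT; have := iid_rewards_le1 iidX j w tT.
  move: (X t i w) (X t j w) (X t (I w) w) => x y z y1 y0 x1 x0 yz xz.
  by have [xy|xy] := leP x y; nra.
apply: le_trans.
rewrite /h !expectationD ?expectationZl ?rpredD ?Lfun_scale//.
rewrite !(iid_rewards_sqr iidX)// (iid_rewardsM iidX)//.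
rewrite !(iid_rewards_mean iidX)//.
rewrite -!EFinM -!EFinD lee_fin.
(* The variance of arm [j] and the squared difference of the means are dropped from the second
   moment of [X t i - X t j]. *)
have := arm_variance_ge0 D j.
have := sqr_ge0 (arm_mean D i - arm_mean D j).
by lra.
Qed.

(** * Plays and rewards in the rounds after the queries *)

Section run_after_queries.
Variables (k : nat) (pi : policy R n S).
Hypothesis mpi : measurable_policy pi.

Definition played_after (m : nat) (w : Omega) : 'I_n :=
  played pi (U w) (fun s j => X (k + s)%N j w) m.

Definition play_prob (m : nat) (i : 'I_n) : R :=
  fine (P [set w | played_after m w = i]).

Lemma measurable_played_after m i : (k + m <= T)%N ->
  measurable [set w | played_after m w = i].
Proof.
move=> kmT.
apply: (@measurable_played _ _ _ _ _ _ pi U (fun s => X (k + s)%N)) => //.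
  exact: (iid_rewards_measurable_seed iidX).
move=> s j sm; apply: (iid_rewards_measurable iidX).
by rewrite (leq_trans _ kmT)// ltn_add2l.
Qed.

(** The arm of round [k + m] depends only on the seed and on earlier rewards, so [measurable_played]
    applies over the sigma-algebra that omits [X (k + m) i]. Hence the choice is independent of the
    reward it collects. *)
Lemma other_rewards_played_after m i : (k + m < T)%N ->
  <<s other_rewards_rect U X T (k + m) i >> [set w | played_after m w = i].
Proof.
move=> kmT.
apply: (@measurable_played _
  (g_sigma_algebraType (other_rewards_rect U X T (k + m) i)) _ _ _ _ pi U
  (fun s => X (k + s)%N)) => //.
  exact: other_rewards_measurable_seed.
move=> s j sm; apply: other_rewards_measurable.
  by rewrite (ltn_trans _ kmT)// ltn_add2l.
by rewrite xpair_eqE eqn_add2l ltn_eqF.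
Qed.

Lemma play_prob_ge0 m i : 0 <= play_prob m i.
Proof. by rewrite fine_ge0. Qed.

Lemma expectation_play m i : (k + m <= T)%N ->
  ('E_P[\1_[set w | played_after m w = i]] = (play_prob m i)%:E)%E.
Proof.
move=> kmT; rewrite expectation_indic; last exact: measurable_played_after.
by rewrite /play_prob fineK// fin_num_measure//; exact: measurable_played_after.
Qed.

Lemma indic_play_Lfun m i : (k + m <= T)%N ->
  (\1_[set w | played_after m w = i] : Omega -> R) \in Lfun P 1.
Proof.
move=> kmT; apply: (@bounded_Lfun1 _ _ _ _ _ 1).
  by apply: measurable_indic; exact: measurable_played_after.
by move=> w; rewrite indicE normr_nat lern1 leq_b1.
Qed.

Lemma sum_play_prob m : (k + m <= T)%N -> \sum_i play_prob m i = 1.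
Proof.
move=> kmT; apply: EFin_inj; rewrite -sumEFin.
under eq_bigr do rewrite -expectation_play//.
rewrite -expectation_sum_ord => [|i]; last exact: indic_play_Lfun.
rewrite -(expectation_cst P 1); congr expectation; apply/funext => w /=.
rewrite (bigD1 (played_after m w))//= indicE mem_set// big1 ?addr0//.
by move=> i ineq; rewrite indicE memNset//= => /esym/eqP; rewrite (negbTE ineq).
Qed.

Lemma reward_playedE m w : X (k + m) (played_after m w) w =
  \sum_i \1_[set w | played_after m w = i] w * X (k + m) i w.
Proof.
rewrite (bigD1 (played_after m w))//= indicE mem_set// mul1r big1 ?addr0//.
move=> i ineq; rewrite indicE memNset ?mul0r//= => /esym/eqP.
by rewrite (negbTE ineq).
Qed.

Lemma reward_played_Lfun m : (k + m < T)%N ->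
  (fun w => X (k + m) (played_after m w) w) \in Lfun P 1.
Proof.
move=> kmT; apply: (@bounded_Lfun1 _ _ _ _ _ 1); last first.
  move=> w; rewrite ger0_norm; first exact: (iid_rewards_le1 iidX).
  exact: (iid_rewards_ge0 iidX).
under eq_fun do rewrite reward_playedE.
apply: measurable_sum => i; apply: measurable_funM.
  by apply: measurable_indic; apply: measurable_played_after; exact: ltnW.
exact: (iid_rewards_measurable iidX).
Qed.

Lemma expectation_reward_played m : (k + m < T)%N ->
  ('E_P[fun w => X (k + m) (played_after m w) w] =
   (\sum_i play_prob m i * arm_mean D i)%:E)%E.
Proof.
move=> kmT.
under [X in expectation _ X]eq_fun do rewrite reward_playedE.
rewrite expectation_sum_ord => [|i]; last first.
  apply: (@bounded_Lfun1 _ _ _ _ _ 1).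
    apply: measurable_funM; last exact: (iid_rewards_measurable iidX).
    by apply: measurable_indic; apply: measurable_played_after; exact: ltnW.
  move=> w; rewrite indicE normrM normr_nat.
  rewrite ger0_norm ?(iid_rewards_ge0 iidX)//.
  rewrite mulr_ile1 ?(iid_rewards_ge0 iidX) ?(iid_rewards_le1 iidX)//.
  by rewrite lern1 leq_b1.
rewrite -sumEFin; apply: eq_bigr => i _.
rewrite (iid_rewards_indepM iidX)// ?expectation_play ?EFinM//;
  first exact: ltnW.
by apply: measurable_indic; exact: other_rewards_played_after.
Qed.

Lemma expectation_plays M i : (k + M <= T)%N ->
  ('E_P[fun w => (\sum_(t < M) (played_after t w == i))%N%:R] =
   (\sum_(m < M) play_prob m i)%:E)%E.
Proof.
move=> kMT.
have kmT (m : 'I_M) : (k + m <= T)%N.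
  by rewrite (leq_trans _ kMT)// leq_add2l ltnW.
rewrite -sumEFin.
under eq_bigr do rewrite -expectation_play//.
rewrite -expectation_sum_ord => [|m]; last exact: indic_play_Lfun.
congr expectation; apply/funext => w; rewrite natr_sum; apply: eq_bigr => m _.
by rewrite indicE; congr (nat_of_bool _)%:R; apply/eqP/idP; rewrite inE.
Qed.

End run_after_queries.
End regret_decomposition.

(** * Rewards seen by the restarted policy *)

Section iid_shift.
Context (R : realType) (n : nat) d (Omega : measurableType d)
  (P : probability Omega R) (dS : measure_display) (S : measurableType dS)
  (U : Omega -> S) (D : 'I_n -> probability (measurableTypeR R) R)
  (X : nat -> 'I_n -> Omega -> R) (T k : nat).

(** Lets the guarantee of UCB-V be applied to the run after the queries, at horizon [T - k]. *)
Lemma iid_rewards_shift : (k <= T)%N -> iid_rewards P U D X T ->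
  iid_rewards P U D (fun s => X (k + s)%N) (T - k).
Proof.
move=> kT [mU mX X01 PX prodP].
have shift t : (t < T - k)%N -> (k + t < T)%N by rewrite ltn_subRL.
split=> //.
- by move=> t i /shift; exact: mX.
- by move=> t i w /shift; exact: X01.
- by move=> t i A /shift; exact: PX.
move=> V B mV mB.
(* Full events in the first [k] rounds contribute factors 1 to the product. *)
pose B' t i : set (measurableTypeR R) :=
  if (t < k)%N then setT else B (t - k)%N i.
have mB' t i : measurable (B' t i) by rewrite /B'; case: ifP.
rewrite (_ : [set _ | _] =
  [set w | V (U w) /\ forall t i, (t < T)%N -> B' t i (X t i w)]); last first.
  apply/seteqP; split=> w /= [Vw Bw]; split=> // t i tT.
    rewrite /B'; case: ltnP => // kt; rewrite -[in X t](subnKC kt).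
    by apply: Bw; rewrite ltn_sub2r// (leq_ltn_trans kt).
  by have := Bw (k + t)%N i (shift t tT); rewrite /B' ltnNge leq_addr/= addKn.
rewrite prodP//; congr (_ * _)%E.
have := subnKC kT; move: (T - k)%N => M TE; rewrite -TE big_split_ord/=.
rewrite big1 ?mul1e => [|t _]; last first.
  by rewrite big1// => i _; rewrite /B' ltn_ord preimage_setT probability_setT.
apply: eq_bigr => t _; apply: eq_bigr => i _.
by rewrite /B' ltnNge leq_addr/= addKn.
Qed.
End iid_shift.

(** * Regret in terms of gaps, plays and query gain *)

Section regret_bound.
Context (R : realType) (n : nat) d (Omega : measurableType d)
  (P : probability Omega R) (dS : measure_display) (S : measurableType dS)
  (U : Omega -> S) (D : 'I_n -> probability (measurableTypeR R) R)
  (X : nat -> 'I_n -> Omega -> R) (T : nat).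
Hypothesis iidX : iid_rewards P U D X T.

(** Each queried round earns at least [g] above the best mean, and each later round loses the
    average of the gaps under its play probabilities. *)
Lemma regret_query_then_run_le (k : nat) (istar : nat -> Omega -> 'I_n)
    (pi : policy R n S) (j : 'I_n) (g : R) : (k <= T)%N ->
  best_action_oracle X T istar -> measurable_policy pi ->
  (forall i, arm_mean D i <= arm_mean D j) ->
  (forall t, (t < k)%N ->
     ((arm_mean D j + g)%:E <= 'E_P[fun w => X t (istar t w) w])%E) ->
  (regret P X T (query_then_run k istar pi U X) <=
   (\sum_i (arm_mean D j - arm_mean D i) *
      (\sum_(m < T - k) play_prob P U X k pi m i) - k%:R * g)%:E)%E.
Proof.
move=> kT best mpi jmax gain.
have shift m : (m < T - k)%N -> (k + m < T)%N by rewrite ltn_subRL.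
pose I := query_then_run k istar pi U X.
have Ik t w : (t < k)%N -> I t w = istar t w.
  by rewrite /I /query_then_run => ->.
have IM m w : I (k + m)%N w = played_after U X k pi m w.
  by rewrite /I /query_then_run ltnNge leq_addr/= addKn.
have IL (t : 'I_T) : (fun w => X t (I t w) w) \in Lfun P 1.
  have [tk|kt] := ltnP t k.
    under eq_fun do rewrite Ik//.
    by apply: (best_reward_Lfun iidX) => // w j'; exact: best.
  have tE : t = (k + (t - k))%N :> nat by rewrite subnKC.
  rewrite tE; under eq_fun do rewrite IM.
  by apply: (reward_played_Lfun iidX) => //; rewrite -tE.
rewrite /regret -/I expectation_sum_ord//.
have le1 : (\big[maxe/-oo]_(i < n) \sum_(t < T) 'E_P[X t i] <=
    (T%:R * arm_mean D j)%:E)%E.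
  apply/bigmax_leP; split=> [|i _]; first exact: leNye.
  under eq_bigr do rewrite (iid_rewards_mean iidX)//.
  rewrite sumEFin lee_fin sumr_const card_ord -[_ *+ _]mulr_natl.
  by rewrite ler_wpM2l.
have le2 : ((k%:R * (arm_mean D j + g) + \sum_(m < T - k)
     \sum_i play_prob P U X k pi m i * arm_mean D i)%:E <=
   \sum_(t < T) 'E_P[fun w => (X t (I t w) w)%R])%E.
  rewrite -(big_mkord xpredT (fun t => 'E_P[fun w => (X t (I t w) w)%R])%E).
  rewrite (@big_cat_nat _ _ _ k)//= EFinD leeD//.
    rewrite big_mkord mulr_natl -[in leLHS](card_ord k) -sumr_const -sumEFin.
    apply: lee_sum => t _; under [X in expectation _ X]eq_fun do rewrite Ik//.
    exact: gain.
  rewrite -[in leRHS](add0n k) big_addn big_mkord -sumEFin.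
  apply: lee_sum => m _; rewrite addnC.
  under [X in expectation _ X]eq_fun do rewrite IM.
  by rewrite (expectation_reward_played iidX)//; exact: shift.
apply: (le_trans (leeB le1 le2)).
rewrite -EFinB lee_fin.
under [in leRHS]eq_bigr do rewrite mulr_sumr.
rewrite [in leRHS]exchange_big/=.
(* The play probabilities of a round sum to 1, so the best mean can be spread over the arms. *)
have -> : \sum_(m < T - k) \sum_i
      (arm_mean D j - arm_mean D i) * play_prob P U X k pi m i =
    (T - k)%:R * arm_mean D j -
    \sum_(m < T - k) \sum_i play_prob P U X k pi m i * arm_mean D i.
  have -> : (T - k)%:R * arm_mean D j = \sum_(m < T - k) arm_mean D j.
    by rewrite sumr_const card_ord mulr_natl.
  rewrite -sumrB.
  apply: eq_bigr => m _.
  rewrite -[X in X - _]mulr1.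
  rewrite -(sum_play_prob iidX mpi (ltnW (shift m (ltn_ord m)))).
  by rewrite mulr_sumr -sumrB; apply: eq_bigr => i _; ring.
rewrite -{1}(subnKC kT) natrD.
lra.
Qed.
End regret_bound.

(** * Final bound from the guarantee of UCB-V *)

Lemma ln2_ge_half (R : realType) : 2^-1 <= ln 2 :> R.
Proof.
(* The inequality [ln (1 + x) <= x] at [x = - 1 / 2]. *)
have := @le_ln1Dx R (- 2^-1); rewrite (_ : 1 - 2^-1 = 2^-1); last by field.
by rewrite lnV ?posrE// lerN2; apply; lra.
Qed.

Theorem theorem4p5 (R : realType)
    (ucbv_guarantee : exists C : R, 0 < C /\ ucbv_plays_bound C) :
  exists C' : R, 0 < C' /\
  forall (n T k : nat), (1 <= n)%N -> (1 <= T)%N -> (1 <= k <= T)%N ->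
  forall (d : measure_display) (Omega : measurableType d)
         (P : probability Omega R)
         (dS : measure_display) (S : measurableType dS) (U : Omega -> S)
         (D : 'I_n -> probability (measurableTypeR R) R)
         (X : nat -> 'I_n -> Omega -> R)
         (istar : nat -> Omega -> 'I_n) (pi : policy R n S),
  iid_rewards P U D X T -> best_action_oracle X T istar -> is_ucbv pi ->
  (regret P X T (query_then_run k istar pi U X) <=
   (C' * Num.min (n%:R * T%:R * ln T%:R / k%:R)
                 (Num.sqrt (n%:R * T%:R * ln T%:R)))%:E)%E.
Proof.
have [C [C0 plays]] := ucbv_guarantee.
(* The 5 is that of [regret_min_bound], used with [B = C + 2]: this dominates [C] and makes
   [B * ln T] at least 1 when [T >= 2], which covers runs of at most one round. *)
exists (5 * (C + 2)); split; first by lra.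
move=> n T k n0 T0 /andP[k0 kT] d Omega P dS S U D X istar pi iidX best ucbv.
have mpi : measurable_policy pi by case: ucbv.
pose mu := arm_mean D; pose v := arm_variance D.
pose j := [arg max_(i > Ordinal n0) mu i]%O.
have jmax i : mu i <= mu j by rewrite /j; case: arg_maxP => // l _ /(_ i isT).
have gapE i : gap D i = mu j - mu i.
  rewrite /gap; congr (_ - _); apply/eqP; rewrite eq_le; apply/andP; split.
    by apply/bigmax_leP; split=> [|l _]; exact: jmax.
  exact: le_bigmax.
have gap_ge0 i : 0 <= gap D i by rewrite gapE subr_ge0.
have gap_le1 i : gap D i <= 1.
  rewrite gapE; have := arm_mean_ge0 iidX i T0; have := arm_mean_le1 iidX j T0.
  by rewrite -/(mu i) -/(mu j); lra.
(* The largest of 0 and the lower bounds of [best_reward_gain] over suboptimal arms. It is thus a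
   valid gain for every query, and [v i <= 2 * g + gap D i] holds by construction. *)
pose g := \big[Num.max/0]_(i | 0 < gap D i) ((v i - gap D i) / 2).
have g0 : 0 <= g by exact: bigmax_ge_id.
have gain t : (t < k)%N ->
    ((mu j + g)%:E <= 'E_P[fun w => X t (istar t w) w])%E.
  move=> tk; have tT := leq_trans tk kT.
  have bestt w i : X t i w <= X t (istar t w) w by exact: best.
  have EXf := expectation_fin_num (best_reward_Lfun iidX tT bestt).
  rewrite -(fineK EXf) lee_fin -lerBrDl; apply/bigmax_leP; split=> [|i gap0].
    by rewrite subr_ge0 -lee_fin (fineK EXf); exact: (best_reward_ge iidX).
  have ij : i != j.
    by apply: contraTneq gap0 => ->; rewrite gapE subrr ltxx.
  by rewrite lerBrDl -lee_fin (fineK EXf) gapE; exact: (best_reward_gain iidX).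
pose N i := \sum_(m < T - k) play_prob P U X k pi m i.
have kmT (m : 'I_(T - k)) : (k + m <= T)%N by rewrite ltnW// -ltn_subRL.
have N0 i : 0 <= N i by apply: sumr_ge0 => m _; exact: play_prob_ge0.
have sumN : \sum_i N i = (T - k)%:R.
  rewrite exchange_big/= -[in RHS](card_ord (T - k)) -sumr_const.
  by apply: eq_bigr => m _; exact: (sum_play_prob iidX).
apply: (le_trans (regret_query_then_run_le iidX kT best mpi jmax gain)).
rewrite lee_fin -/N -/mu.
(* For [T = 1] the bound is 0 since [ln 1 = 0]; the only round is queried, so no gap is paid. *)
have [T1|T1] := leqP T 1.
  have TE : T = 1%N by apply/eqP; rewrite eqn_leq T1.
  have Tk0 : (T - k)%N = 0%N by apply/eqP; rewrite subn_eq0 TE.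
  rewrite big1 => [|i _]; last first.
    by rewrite /N big1 ?mulr0// => -[m mTk]; exfalso; rewrite Tk0 in mTk.
  by rewrite TE ln1 mulr0 mul0r sqrtr0 minxx mulr0 sub0r oppr_le0 mulr_ge0.
have lnT : 2^-1 <= ln T%:R :> R.
  by apply: (le_trans (ln2_ge_half R)); rewrite ler_ln ?posrE ?ltr0n ?ler_nat.
under eq_bigr do rewrite -gapE.
apply: (@regret_min_bound R n T%:R k%:R (ln T%:R) (C + 2) g (gap D) N v) => //.
- by rewrite ltr0n ler_nat k0.
- by lra.
- by lra.
- by move=> i; rewrite gap_ge0 gap_le1.
- by rewrite sumN ler_nat leq_subr.
- by move=> i; rewrite arm_variance_ge0 (arm_variance_le1 iidX).
- move=> i; have v0 := arm_variance_ge0 D i; rewrite -/(v i) in v0.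
  have [->|gapn0] := eqVneq (gap D i) 0.
    by rewrite mul0r addr0 !mulr_ge0//; lra.
  have gap0 : 0 < gap D i by rewrite lt_neqAle eq_sym gapn0 gap_ge0.
  have vgap : 0 <= v i + gap D i by rewrite addr_ge0.
  (* The guarantee requires a horizon of at least 2. Multiplied by the gap, it has the form wanted,
     without a division. *)
  have [M2|M1] := leqP 2 (T - k).
    have iidXk := iid_rewards_shift kT iidX.
    have := plays n _ M2 _ _ P _ _ U D _ pi iidXk ucbv i gap0.
    have kMT : (k + (T - k) <= T)%N by rewrite subnKC.
    have := expectation_plays iidX mpi i kMT; rewrite /played_after => ->.
    rewrite -EFinM lee_fin => /(ler_wpM2l (gap_ge0 i)).
    rewrite -/(N i) -/(v i) => /le_trans; apply.
    have -> : gap D i * (C * (v i / gap D i + 1) * ln (T - k)%:R) =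
      C * ln (T - k)%:R * (v i + gap D i) by field.
    rewrite ler_wpM2r//.
    have lnM0 : 0 <= ln (T - k)%:R :> R by rewrite ln_ge0// ler1n ltnW.
    have lnMT : ln (T - k)%:R <= ln T%:R :> R.
      by rewrite ler_ln ?posrE ?ltr0n ?ler_nat ?leq_subr// ltnW.
    by rewrite ler_pM//; lra.
  (* At most one round remains: the left-hand side is at most the gap, and [(C + 2) * ln T >= 1]. *)
  have N1 : N i <= 1.
    apply: (@le_trans _ _ (\sum_i N i)); last by rewrite sumN lern1.
    by rewrite (bigD1 i)//= lerDl sumr_ge0.
  apply: (@le_trans _ _ (gap D i)).
    by rewrite ler_piMr// mulr_ile1 ?gap_le1.
  apply: (@le_trans _ _ (v i + gap D i)); first by rewrite lerDr.
  by rewrite ler_peMl//; nra.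
- move=> i gap0.
  have : (v i - gap D i) / 2 <= g by rewrite /g; exact: le_bigmax_cond.
  by lra.
Qed.
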